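(* The set $Z$ is inner approximated by $Z_R$, i.e. $Z_R\subseteq Z$, where $$Z_R=\left\{x\in\mathbb{R}^n:\ \frac{\delta}{\epsilon}\|a(x)\|_*+a(x)^\top\zeta_i^j\le b_i(x),\ \forall j\in[N],\ i\in[I]\right\}.$$
   Context: Let $n,I,N$ be positive integers, $[R]:=\{1,\dots,R\}$, $\epsilon\in(0,1)$, $\delta>0$. Let $\eta_1,\eta_2\in\{0,1\}$ with $\eta_1+\eta_2\ge1$. For $x\in\mathbb{R}^n$ let $a(x)=\begin{pmatrix}\eta_1x\\ \eta_2\end{pmatrix}\in\mathbb{R}^{n+1}$ and, for $i\in[I]$, $b_i(x)=B_i^\top x+b^i$ with given $B_i\in\mathbb{R}^n$, $b^i\in\mathbb{R}$. The uncertain parameter $\xi=(\xi_1,\dots,\xi_I)$, $\xi_i\in\mathbb{R}^{n+1}$, takes values in $\Xi=\mathbb{R}^{I\times(n+1)}$, equipped with a norm $\|\cdot\|$. For $a\in\mathbb{R}^{n+1}$ the dual norm is $\|a\|_*=\sup\{a^\top u_i:\ u=(u_1,\dots,u_I)\in\Xi,\ \|u\|\le1\}$, where the norm is such that this value does not depend on $i\in[I]$ (as for any $L_p$ norm). Samples $\zeta^1,\dots,\zeta^N\in\Xi$, $\zeta^j=(\zeta^j_1,\dots,\zeta^j_I)$, are given (realizations of i.i.d. samples from a true distribution); the empirical distribution $\mathbb{P}_{\tilde\zeta}$ gives mass $1/N$ to each $\zeta^j$, $j\in[N]$. The Wasserstein distance of probability distributions on $\Xi$ is $$W(\mathbb{P}_1,\mathbb{P}_2)=\inf\left\{\int_{\Xi\times\Xi}\|\xi_1-\xi_2\|\,\mathbb{Q}(d\xi_1,d\xi_2):\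 \mathbb{Q}\text{ a joint distribution with marginals }\mathbb{P}_1,\mathbb{P}_2\right\},$$ and the ambiguity set is $\mathcal{P}=\{\mathbb{P}:\ \mathbb{P}\{\tilde\xi\in\Xi\}=1,\ W(\mathbb{P},\mathbb{P}_{\tilde\zeta})\le\delta\}$. Define $$Z=\left\{x\in\mathbb{R}^n:\ \inf_{\mathbb{P}\in\mathcal{P}}\mathbb{P}\left\{\tilde\xi:\ a(x)^\top\tilde\xi_i\le b_i(x),\ \forall i\in[I]\right\}\ge1-\epsilon\right\}.$$ *)

(* Defs.v *)
From HB Require Import structures.
From mathcomp Require Import all_boot all_order all_algebra.
From mathcomp Require Import all_classical all_reals all_analysis.

Set Implicit Arguments.
Unset Strict Implicit.
Unset Printing Implicit Defensive.

Import Order.TTheory GRing.Theory Num.Theory.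
Import numFieldNormedType.Exports.

Local Open Scope classical_set_scope.
Local Open Scope ring_scope.

(* Row i of a matrix in R^(I x (n+1)) is the (transposed) vector xi_i. The
   sigma-algebra is generated by the sets that are open for the entrywise
   topology; since all norms on a finite-dimensional space are equivalent, these
   are the Borel sets of any norm. *)
Notation Xi R I n := (g_sigma_algebraType (@open 'M[R]_(I, n + 1))).

(* The space of matrices carries the max norm as a canonical instance, hence an
   arbitrary norm is a function together with its axioms. *)
Record is_norm (R : realType) (V : lmodType R) (N : V -> R) : Prop := IsNorm {
  is_norm_triangle : forall u v, N (u + v) <= N u + N v ;
  is_norm_homogeneous : forall (c : R) u, N (c *: u) = `|c| * N u ;
  is_norm_definite : forall u, N u = 0 -> u = 0 }.

Section ambiguity.
Context (R : realType) (I n : nat).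

(* a^T xi_i *)
Definition row_dot (a : 'cV[R]_(n + 1)) (u : 'M[R]_(I, n + 1)) (i : 'I_I) : R :=
  (row i u *m a) 0 0.

(* A real supremum: the set contains 0 and, as norms on a finite-dimensional
   space are equivalent, is bounded. *)
Definition dual_norm (nrm : 'M[R]_(I, n + 1) -> R) (i : 'I_I)
    (a : 'cV[R]_(n + 1)) : R :=
  sup [set row_dot a u i | u in [set u | nrm u <= 1]].

Definition empirical (N : nat) (zeta : 'I_N -> Xi R I n) (A : set (Xi R I n))
    : \bar R :=
  ((N%:R^-1)%:E * \sum_(j < N) \d_(zeta j) A)%E.

Section empirical_probability.
Variables (N : nat) (N_gt0 : (0 < N)%N) (zeta : 'I_N -> Xi R I n).

Let empirical0 : empirical zeta set0 = 0%E.
Proof. by rewrite /empirical big1 ?mule0// => j _; rewrite measure0. Qed.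

Let empirical_ge0 A : (0 <= empirical zeta A)%E.
Proof.
by rewrite mule_ge0 ?lee_fin ?invr_ge0 ?ler0n// sume_ge0.
Qed.

Let empirical_sigma_additive : semi_sigma_additive (empirical zeta).
Proof.
move=> F mF tF mUF; rewrite /empirical.
rewrite [X in X @ _ --> _](_ : _ = (fun k =>
  (N%:R^-1)%:E * \sum_(j < N) \sum_(0 <= i < k) \d_(zeta j) (F i))%E); last first.
  apply/funext => k; rewrite exchange_big/= ge0_sume_distrr//.
  by move=> i _; apply: sume_ge0.
apply: cvgeZl => //; apply: cvg_nnesum => // j _.
  by apply: nearW => k; apply: sume_ge0.
exact: measure_semi_sigma_additive.
Qed.

HB.instance Definition _ := isMeasure.Build _ _ _ (empirical zeta)
  empirical0 empirical_ge0 empirical_sigma_additive.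

Lemma empirical_setT : empirical zeta [set: Xi R I n] = 1%E.
Proof.
rewrite /empirical (eq_bigr (fun=> 1%E)); last by move=> j _; rewrite diracT.
rewrite sumEFin sumr_const card_ord -EFinM mulVf//.
by rewrite pnatr_eq0 -lt0n.
Qed.

Definition empirical_probability : probability (Xi R I n) R :=
  HB.pack (empirical zeta)
    (Measure_isProbability.Build _ _ R (empirical zeta) empirical_setT).

End empirical_probability.

Definition coupling (P1 P2 : probability (Xi R I n) R)
    (Q : probability (Xi R I n * Xi R I n)%type R) : Prop :=
  forall A, measurable A ->
    Q (A `*` setT) = P1 A /\ Q (setT `*` A) = P2 A.

Definition wasserstein (nrm : 'M[R]_(I, n + 1) -> R)
    (P1 P2 : probability (Xi R I n) R) : \bar R :=
  ereal_inf [set (\int[Q]_p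
                    (nrm ((p.1 : 'M[R]_(I, n + 1)) - p.2))%:E)%E
            | Q in coupling P1 P2].

Definition ambiguity_set (nrm : 'M[R]_(I, n + 1) -> R) (delta : R)
    (P0 : probability (Xi R I n) R) : set (probability (Xi R I n) R) :=
  [set P | (wasserstein nrm P P0 <= delta%:E)%E].

Definition avec (eta1 eta2 : R) (x : 'cV[R]_n) : 'cV[R]_(n + 1) :=
  col_mx (eta1 *: x) eta2%:M.

Definition bfun (B : 'I_I -> 'cV[R]_n) (b : 'I_I -> R) (i : 'I_I)
    (x : 'cV[R]_n) : R :=
  ((B i)^T *m x) 0 0 + b i.

Definition safe_set (eta1 eta2 : R) (B : 'I_I -> 'cV[R]_n) (b : 'I_I -> R)
    (x : 'cV[R]_n) : set (Xi R I n) :=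
  [set u | forall i, row_dot (avec eta1 eta2 x) u i <= bfun B b i x].

Definition Z (nrm : 'M[R]_(I, n + 1) -> R) (eps delta eta1 eta2 : R)
    (B : 'I_I -> 'cV[R]_n) (b : 'I_I -> R) (P0 : probability (Xi R I n) R)
    : set 'cV[R]_n :=
  [set x | (ereal_inf [set P (safe_set eta1 eta2 B b x)
                      | P in ambiguity_set nrm delta P0]
            >= (1 - eps)%:E)%E].

Definition ZR (dnorm : 'cV[R]_(n + 1) -> R) (eps delta eta1 eta2 : R)
    (B : 'I_I -> 'cV[R]_n) (b : 'I_I -> R) (N : nat) (zeta : 'I_N -> Xi R I n)
    : set 'cV[R]_n :=
  [set x | forall (j : 'I_N) (i : 'I_I),
     delta / eps * dnorm (avec eta1 eta2 x)
       + row_dot (avec eta1 eta2 x) (zeta j) i <= bfun B b i x].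

End ambiguity.

(* Main.v *)
Require Import Defs.
From mathcomp Require Import all_boot all_order all_algebra.
From mathcomp Require Import all_classical all_reals all_analysis.
Import Order.TTheory GRing.Theory Num.Theory.
Import numFieldNormedType.Exports.

(** The argument is Markov's inequality for the transport cost.

    Let x satisfy the constraints that define Z_R, and call u unsafe when it
    violates some constraint i, that is, a(x)^T u_i > b_i(x). The row functional
    v |-> a(x)^T v_i is bounded by ||a(x)||_* ||v||, while every sample leaves the
    slack (delta / eps) ||a(x)||_* in constraint i; hence an unsafe u lies at
    distance at least delta / eps from every sample ([unsafe_far_from_sample]).
    The second marginal of a coupling of P with the empirical distribution is
    carried by the samples, so the coupling moves all of the mass that P gives
    to unsafe points over a distance at least delta / eps. Its cost is then at
    least (delta / eps) P(unsafe) ([transport_cost_ge]). Taking the infimum over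
    the couplings, (delta / eps) P(unsafe) <= W <= delta, so P(unsafe) <= eps.

    Two points need care. The dual norm is a supremum of reals, which dominates
    the functional only if the unit ball of the norm is bounded: this is the
    equivalence of an arbitrary norm with the max norm, obtained by compactness
    of the unit sphere ([max_norm_le_norm]). And the transport cost is bounded
    below straight from the definition of the integral, by the simple function
    equal to delta / eps on the pairs (unsafe point, sample) and to 0 elsewhere
    ([markov_le_integral]). *)

Set Implicit Arguments.
Unset Strict Implicit.
Unset Printing Implicit Defensive.

Local Open Scope classical_set_scope.
Local Open Scope ring_scope.

(** * Norms on a space of matrices *)

(** Exchanging u and v turns the one-sided bound into a bound on |f u - f v|. *)
Lemma lipschitz_continuous (R : realType) (V : normedModType R) (f : V -> R)
    (C : R) :
  (forall u v, f u - f v <= C * `|u - v|) -> continuous f.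
Proof.
move=> fC u; apply/cvgrPdist_le => e e_gt0.
(* C may be 0 or negative; `|C| + 1 is a positive Lipschitz constant. *)
have C1_gt0 : 0 < `|C| + 1 by rewrite ltr_wpDl.
have : \forall v \near u, `|u - v| <= e / (`|C| + 1).
  by apply: (@cvgr_dist_le _ _ _ _ _ idfun); [exact: cvg_id|rewrite divr_gt0].
apply: filterS => v uv.
have Ce : C * `|u - v| <= e.
  have := ler_wpM2l (ltW C1_gt0) uv; rewrite mulrCA divff ?gt_eqF// mulr1.
  apply: le_trans; apply: ler_wpM2r => //.
  by rewrite (le_trans (ler_norm C))// lerDl.
rewrite ler_norml lerNl opprB (le_trans (fC u v))// andbT.
by rewrite (le_trans (fC v u))// distrC.
Qed.

Lemma coord_le_mx_norm (R : realType) (m n : nat) (u : 'M[R]_(m, n)) i j :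
  `|u i j| <= `|u|.
Proof.
rewrite [leRHS]/Num.norm /= mx_normrE.
by apply/bigmax_geP; right; exists (i, j).
Qed.

Section norms.
Context (R : realType) (V : lmodType R) (N : V -> R) (N_norm : is_norm N).

Lemma is_norm0 : N 0 = 0.
Proof. by rewrite -(scale0r 0) is_norm_homogeneous// normr0 mul0r. Qed.

Lemma is_normN u : N (- u) = N u.
Proof. by rewrite -scaleN1r is_norm_homogeneous// normrN1 mul1r. Qed.

Lemma is_norm_ge0 u : 0 <= N u.
Proof.
have := is_norm_triangle N_norm u (- u).
by rewrite subrr is_norm0 is_normN -mulr2n pmulrn_lge0.
Qed.

Lemma is_norm_sub u v : N u - N v <= N (u - v).
Proof. by rewrite lerBlDr -{1}(subrK v u) is_norm_triangle. Qed.

Lemma is_norm_sum (J : Type) (s : seq J) (F : J -> V) :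
  N (\sum_(j <- s) F j) <= \sum_(j <- s) N (F j).
Proof.
elim/big_ind2 : _ => //; first by rewrite is_norm0.
by move=> c u d v uc vd; rewrite (le_trans (is_norm_triangle N_norm u v))// lerD.
Qed.

End norms.

Lemma norm_le_max_norm (R : realType) (m : nat) (N : 'rV[R]_m -> R) :
  is_norm N -> exists C, forall v, N v <= C * `|v|.
Proof.
move=> N_norm; exists (\sum_j N (delta_mx 0 j)) => v.
rewrite {1}(row_sum_delta v) mulr_suml.
rewrite (le_trans (is_norm_sum N_norm _ _))// ler_sum// => j _.
rewrite is_norm_homogeneous// mulrC ler_wpM2l ?is_norm_ge0//.
exact: coord_le_mx_norm.
Qed.

(** A norm N is continuous for the max norm, hence attains a minimum N c > 0 on
    the compact unit sphere of the max norm; by homogeneity the constant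
    1 / N c works everywhere. *)
Lemma max_norm_le_norm (R : realType) (m : nat) (N : 'rV[R]_m -> R) :
  is_norm N -> exists C, forall v, `|v| <= C * N v.
Proof.
move=> N_norm.
have N_cont : continuous N.
  have [C NC] := norm_le_max_norm N_norm.
  apply: (@lipschitz_continuous _ _ _ C) => u v.
  exact: le_trans (is_norm_sub N_norm u v) (NC _).
pose S := [set v : 'rV[R]_m | `|v| = 1].
have S_compact : compact S.
  apply: bounded_closed_compact.
    exists 1; split; first exact: num_real.
    by move=> r r_gt1 v Sv; rewrite /= Sv ltW.
  apply: (@preimage_closed _ _ (fun v : 'rV[R]_m => `|v|) [set 1]).
    by move=> v _; exact: norm_continuous.
  exact: closed_eq.
have normalize v : v != 0 -> S (`|v|^-1 *: v).
  by move=> v_neq0; rewrite /S/= normrZ normfV normr_id mulVf// normr_eq0.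
(* The sphere is empty exactly in dimension 0. *)
have [S_nonempty|S_empty] := pselect (S !=set0); last first.
  exists 0 => v; rewrite mul0r; have [->|/normalize Sv] := eqVneq v 0.
    by rewrite normr0.
  by case: S_empty; exists (`|v|^-1 *: v).
have [c cS c_min] := EVT_min_rV S_nonempty S_compact (continuous_subspaceT N_cont).
have c_neq0 : c != 0.
  by apply/eqP => c0; move: cS; rewrite inE /S/= c0 normr0 => /esym/eqP; rewrite oner_eq0.
have Nc_gt0 : 0 < N c.
  rewrite lt_neqAle is_norm_ge0// andbT eq_sym.
  by apply: contra c_neq0 => /eqP /(is_norm_definite N_norm) ->.
exists (N c)^-1 => v; have [->|v_neq0] := eqVneq v 0.
  by rewrite normr0 mulr_ge0 ?invr_ge0 ?is_norm_ge0.
have := c_min (`|v|^-1 *: v); rewrite inE => /(_ (normalize _ v_neq0)).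
rewrite is_norm_homogeneous// normfV normr_id.
by rewrite !ler_pdivlMl ?normr_gt0// mulrC.
Qed.

(** Flattening a matrix to a row vector preserves the max norm. *)
Lemma mx_max_norm_le_norm (R : realType) (m n : nat) (N : 'M[R]_(m, n) -> R) :
  is_norm N -> exists C, forall u, `|u| <= C * N u.
Proof.
move=> N_norm.
have N_vec_norm : is_norm (N \o vec_mx).
  split => [u v|c u|u] /=.
  - by rewrite linearD is_norm_triangle.
  - by rewrite linearZ is_norm_homogeneous.
  - by move=> /(is_norm_definite N_norm)/eqP; rewrite vec_mx_eq0 => /eqP.
have [C NC] := max_norm_le_norm N_vec_norm; exists C => u.
have := NC (mxvec u); rewrite /= mxvecK; apply: le_trans.
rewrite [leLHS]/Num.norm /= mx_normrE; apply/bigmax_leP; split=> // -[i j] _ /=.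
by rewrite -mxvecE coord_le_mx_norm.
Qed.

(** * The dual norm *)

Section row_dot.
Context (R : realType) (I n : nat).
Implicit Types (a : 'cV[R]_(n + 1)) (u v : 'M[R]_(I, n + 1)) (i : 'I_I).

Lemma row_dotE a u i : row_dot a u i = \sum_k u i k * a k 0.
Proof. by rewrite /row_dot mxE; apply: eq_bigr => k _; rewrite mxE. Qed.

Lemma row_dotB a u v i : row_dot a (u - v) i = row_dot a u i - row_dot a v i.
Proof. by rewrite /row_dot linearB mulmxBl !mxE. Qed.

Lemma row_dotZ a (c : R) u i : row_dot a (c *: u) i = c * row_dot a u i.
Proof. by rewrite /row_dot linearZ -scalemxAl mxE. Qed.

Lemma row_dot_le_mx_norm a i : exists C, forall u, row_dot a u i <= C * `|u|.
Proof.
exists (\sum_k `|a k 0|) => u; rewrite row_dotE mulr_suml ler_sum// => k _.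
rewrite (le_trans (ler_norm _))// normrM mulrC ler_wpM2l//.
exact: coord_le_mx_norm.
Qed.

Lemma row_dot_continuous a i :
  continuous (fun u : 'M[R]_(I, n + 1) => row_dot a u i).
Proof.
have [C aC] := row_dot_le_mx_norm a i.
by apply: (@lipschitz_continuous _ _ _ C) => u v; rewrite -row_dotB.
Qed.

Variables (nrm : 'M[R]_(I, n + 1) -> R) (nrm_norm : is_norm nrm).

(** Without this bound the supremum defining the dual norm would be a default
    value; it holds because the unit ball is bounded for the max norm. *)
Lemma dual_norm_has_ubound a i :
  has_ubound [set row_dot a u i | u in [set u | nrm u <= 1]].
Proof.
have [C aC] := row_dot_le_mx_norm a i.
have [K nrmK] := mx_max_norm_le_norm nrm_norm.
exists (`|C| * `|K|) => _ [u /= u_le1 <-].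
rewrite (le_trans (aC u))// (le_trans (ler_wpM2r (normr_ge0 _) (ler_norm C)))//.
rewrite ler_wpM2l// (le_trans (nrmK u))//.
rewrite (le_trans (ler_wpM2r (is_norm_ge0 nrm_norm _) (ler_norm K)))//.
by rewrite ler_piMr.
Qed.

Lemma dual_norm_ge0 a i : 0 <= dual_norm nrm i a.
Proof.
apply: (ub_le_sup (dual_norm_has_ubound a i)); exists 0 => /=.
  by rewrite is_norm0.
by rewrite -(scale0r 0) row_dotZ mul0r.
Qed.

(** Hoelder's inequality for the pair of a norm and its dual norm. *)
Lemma row_dot_le_dual_norm a u i : row_dot a u i <= dual_norm nrm i a * nrm u.
Proof.
have [->|u_neq0] := eqVneq u 0.
  by rewrite is_norm0// mulr0 -(scale0r 0) row_dotZ mul0r.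
have nrm_gt0 : 0 < nrm u.
  rewrite lt_neqAle is_norm_ge0// andbT eq_sym.
  by apply: contra u_neq0 => /eqP /(is_norm_definite nrm_norm) ->.
rewrite -ler_pdivrMr// mulrC -row_dotZ.
apply: (ub_le_sup (dual_norm_has_ubound a i)); exists ((nrm u)^-1 *: u) => //=.
by rewrite is_norm_homogeneous// normfV gtr0_norm// mulVf// gt_eqF.
Qed.

End row_dot.

(** * Measurability *)

Section measurability.
Context (R : realType) (I n : nat).

Lemma closed_Xi_measurable (A : set 'M[R]_(I, n + 1)) :
  closed A -> measurable (A : set (Xi R I n)).
Proof.
move=> A_closed; rewrite -(setCK A); apply: measurableC.
by apply: sub_sigma_algebra; exact: closed_openC.
Qed.

Lemma measurable_safe_set (eta1 eta2 : R) (B : 'I_I -> 'cV[R]_n)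
    (b : 'I_I -> R) (x : 'cV[R]_n) :
  measurable (safe_set eta1 eta2 B b x).
Proof.
apply: closed_Xi_measurable.
rewrite [X in closed X](_ : _ = \bigcap_i
  ((row_dot (avec eta1 eta2 x))^~ i @^-1` [set r | r <= bfun B b i x])).
  apply: closed_bigI => i _; apply: preimage_closed; last exact: closed_le.
  by move=> u _; exact: row_dot_continuous.
by apply/seteqP; split => u safe_u i; [move=> _; exact: safe_u|exact: safe_u].
Qed.

(** A point of the matrix space is closed, being cut out by its entries. *)
Lemma measurable_range_samples (N : nat) (zeta : 'I_N -> Xi R I n) :
  measurable (range zeta).
Proof.
have -> : range zeta = \bigcup_(j in [set: 'I_N]) [set zeta j].
  apply/seteqP; split => [_ [j _ <-]|u [j _ ->]]; [by exists j|by exists j].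
apply: fin_bigcup_measurable => // j _; apply: closed_Xi_measurable.
rewrite [X in closed X](_ : _ = \bigcap_i \bigcap_k
  ((fun u : 'M[R]_(I, n + 1) => u i k) @^-1` [set zeta j i k])).
  apply: closed_bigI => i _; apply: closed_bigI => k _.
  apply: preimage_closed; last exact: closed_eq.
  by move=> u _; exact: coord_continuous.
apply/seteqP; split => [u -> i _ k _ //|u u_eq].
by apply/matrixP => i k; exact: u_eq.
Qed.

End measurability.

(** * The transport cost of unsafe mass *)

(** The integral of a nonnegative function is the supremum of the integrals of
    the simple functions below it, and c times the indicator of A is one of
    them. *)
Lemma markov_le_integral (d : measure_display) (T : measurableType d)
    (R : realType) (mu : {measure set T -> \bar R}) (f : T -> R) (A : set T)
    (c : R) :
  measurable A -> 0 <= c -> (forall t, 0 <= f t) ->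
  (forall t, A t -> c <= f t) ->
  (c%:E * mu A <= \int[mu]_t (f t)%:E)%E.
Proof.
move=> mA c_ge0 f_ge0 c_le_f.
rewrite ge0_integralTE; last by move=> t; rewrite lee_fin.
apply: ereal_sup_ubound; exists (scale_nnsfun (indic_nnsfun R mA) c_ge0) => /=.
  move=> t; rewrite lee_fin measurable_realfun.mindicE; have [At|_] := boolP (t \in A).
    by rewrite mulr1 c_le_f //; exact: set_mem.
  by rewrite mulr0.
by rewrite sintegralrM sintegral_indic.
Qed.

(** If u were closer than c to z, the duality inequality would give
    a^T u_i <= a^T z_i + c ||a||_* <= beta. This covers ||a||_* = 0, where no
    u is unsafe. *)
Lemma unsafe_far_from_sample (R : realType) (n I : nat)
    (nrm : 'M[R]_(I, n + 1) -> R) (a : 'cV[R]_(n + 1)) (c beta : R) (i : 'I_I)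
    (u z : 'M[R]_(I, n + 1)) :
  is_norm nrm ->
  c * dual_norm nrm i a + row_dot a z i <= beta -> beta < row_dot a u i ->
  c <= nrm (u - z).
Proof.
move=> nrm_norm z_safe u_unsafe; rewrite leNgt; apply/negP => close.
have := row_dot_le_dual_norm nrm_norm a (u - z) i.
rewrite row_dotB lerBlDr leNgt => /negP; apply.
rewrite (le_lt_trans _ u_unsafe)// (le_trans _ z_safe)// lerD2r mulrC.
by rewrite ler_wpM2r ?dual_norm_ge0// ltW.
Qed.

Lemma empirical_off_samples (R : realType) (I n N : nat) (zeta : 'I_N -> Xi R I n) :
  empirical zeta (~` range zeta) = 0%E.
Proof.
rewrite /empirical big1 ?mule0// => j _.
rewrite diracE memNset//= => /(_ _); apply; by exists j.
Qed.

(** Any coupling concentrates on pairs whose second component is a sample, so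
    the mass it gives to A x samples is P A, and on this set the distance is at
    least c. *)
Lemma transport_cost_ge (R : realType) (I n N : nat) (N_gt0 : (0 < N)%N)
    (nrm : 'M[R]_(I, n + 1) -> R) (nrm_norm : is_norm nrm)
    (zeta : 'I_N -> Xi R I n) (P : probability (Xi R I n) R)
    (A : set (Xi R I n)) (c : R) :
  measurable A -> 0 <= c ->
  (forall u j, A u -> c <= nrm ((u : 'M[R]_(I, n + 1)) - zeta j)) ->
  (c%:E * P A <= wasserstein nrm P (empirical_probability N_gt0 zeta))%E.
Proof.
move=> mA c_ge0 A_far; apply: le_ereal_inf_tmp => _ [Q Q_coupling <-].
have mS := measurable_range_samples zeta.
have mSC := measurableC mS.
have offsample0 : Q (A `*` ~` range zeta) = 0%E.
  apply/eqP; rewrite eq_le measure_ge0 andbT.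
  have <- : Q (setT `*` ~` range zeta) = 0%E.
    by rewrite (proj2 (Q_coupling _ mSC)); exact: empirical_off_samples.
  by apply: le_measure; rewrite ?inE; [exact: measurableX..|move=> p []].
have <- : Q (A `*` range zeta) = P A.
  rewrite -(proj1 (Q_coupling A mA)).
  have -> : A `*` setT = (A `*` range zeta) `|` (A `*` ~` range zeta).
    apply/seteqP; split => [p [Ap _]|p [[Ap _]|[Ap _]]] //.
    by have [|] := EM (range zeta p.2); [left|right].
  by rewrite measureU0//; exact: measurableX.
apply: markov_le_integral => //.
- exact: measurableX.
- by move=> p; rewrite is_norm_ge0.
- by move=> p [/= Ap [j _ <-]]; exact: A_far.
Qed.

Theorem theorem4 (R : realType) (n I N : nat)
    (n_gt0 : (0 < n)%N) (I_gt0 : (0 < I)%N) (N_gt0 : (0 < N)%N)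
    (eps delta : R) (eps_gt0 : 0 < eps) (eps_lt1 : eps < 1)
    (delta_gt0 : 0 < delta)
    (eta1 eta2 : R) (eta1_01 : eta1 = 0 \/ eta1 = 1)
    (eta2_01 : eta2 = 0 \/ eta2 = 1) (eta_ge1 : 1 <= eta1 + eta2)
    (B : 'I_I -> 'cV[R]_n) (b : 'I_I -> R)
    (nrm : 'M[R]_(I, n + 1) -> R) (nrm_norm : is_norm nrm)
    (dnorm : 'cV[R]_(n + 1) -> R)
    (dnormE : forall (i : 'I_I) (a : 'cV[R]_(n + 1)),
       dnorm a = dual_norm nrm i a)
    (zeta : 'I_N -> Xi R I n) :
  ZR dnorm eps delta eta1 eta2 B b zeta `<=`
  Z nrm eps delta eta1 eta2 B b (empirical_probability N_gt0 zeta).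
Proof.
move=> x x_ZR; rewrite /Z /=; apply: le_ereal_inf_tmp => _ [P W_le <-].
have mS := measurable_safe_set eta1 eta2 B b x.
set S := safe_set eta1 eta2 B b x in mS *.
have c_gt0 : 0 < delta / eps by rewrite divr_gt0.
have unsafe_far u j : (~` S) u ->
    delta / eps <= nrm ((u : 'M[R]_(I, n + 1)) - zeta j).
  move=> /existsNP[i /negP]; rewrite -ltNge => u_unsafe.
  apply: (unsafe_far_from_sample _ _ u_unsafe) => //.
  by rewrite -dnormE; exact: x_ZR.
have := transport_cost_ge N_gt0 nrm_norm P (measurableC mS) (ltW c_gt0) unsafe_far.
move=> /le_trans/(_ W_le).
rewrite probability_setC//.
have : P S \is a fin_num by exact: fin_num_measure.
case: (P S) => // p _; rewrite -EFinB -EFinM !lee_fin.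
(* Divide the bound on P(unsafe) = 1 - p by delta, then multiply by eps. *)
rewrite -mulrA -[leRHS]mulr1 ler_pM2l// mulrC ler_pdivrMr// mul1r.
by rewrite lerBlDl addrC -lerBlDl.
Qed.
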